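(* If $n\ge d$, then the left $MS$-action and the right $MH$-action on $MV$ have the double centralizer property $$\operatorname{End}_{MH}(MV)\cong MS,\qquad \operatorname{End}_{MS}(MV)\cong MH.$$
   Context: Let $v$ be an indeterminate, $\mathcal{A}=\mathbb{Z}[v,v^{-1}]$, $n,d$ positive integers, $\mathbb{F}_q$ the finite field with $q$ elements, $V=\mathbb{F}_q^d$, $G=GL_d(\mathbb{F}_q)$. Let $\mathscr{X}$ be the set of flags $(0=V_0\subseteq V_1\subseteq\cdots\subseteq V_n=V)$ (inclusions not necessarily strict) and $\mathscr{Y}$ the set of complete flags in $V$. Let $G'=V\rtimes G$ act on $X=\mathscr{X}\times V$ and $Y=\mathscr{Y}\times V$ by $(\omega,g)\cdot(f,\omega_1)=(g\cdot f,\,g\cdot\omega_1+\omega)$, and diagonally on $X\times X$, $Y\times Y$, $X\times Y$. Let $MS=\mathcal{A}_{G'}(X\times X)$, $MH=\mathcal{A}_{G'}(Y\times Y)$, $MV=\mathcal{A}_{G'}(X\times Y)$ be the $\mathcal{A}$-modules of $G'$-invariant $\mathcal{A}$-valued functions. The convolution $$(h_1*h_2)(f,\omega,f',\omega')=\sum_{f'',\omega''}h_1(f,\omega,f'',\omega'')h_2(f'',\omega'',f',\omega')$$ (with $(f'',\omega'')$ running over $X$ or $Y$ as appropriate) makes $MS$ and $MH$ associative $\mathcal{A}$-algebras and equips $MV$ with a left $MS$-action and a right $MH$-action. *)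

(* Defs.v *)
From HB Require Import structures.
From mathcomp Require Import all_boot all_algebra all_fingroup all_field.
From mathcomp Require Import boolp functions.

Set Implicit Arguments.
Unset Strict Implicit.
Unset Printing Implicit Defensive.

Import GRing.Theory.
Local Open Scope ring_scope.

(** Z[v, v^-1], as the subring of Z(v) of the fractions p / v^k. *)

Definition is_laurent : pred {fraction {poly int}} :=
  fun x => `[< exists (p : {poly int}) (k : nat), x * tofrac 'X ^+ k = tofrac p >].

Fact is_laurent_subring : subring_closed is_laurent.
Proof.
split.
- by apply/asboolP; exists 1, 0%N; rewrite mulr1 tofrac1.
- move=> x y /asboolP[p [k px]] /asboolP[q [l qy]]; apply/asboolP.
  exists (p * 'X ^+ l - q * 'X ^+ k), (k + l)%N.
  rewrite tofracB !tofracM -px -qy !tofracXn exprD mulrBl.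
  by rewrite mulrA -mulrA [_ ^+ k * _ ^+ l]mulrC !mulrA.
- move=> x y /asboolP[p [k px]] /asboolP[q [l qy]]; apply/asboolP.
  by exists (p * q), (k + l)%N; rewrite exprD mulrACA px qy tofracM.
Qed.

HB.instance Definition _ :=
  GRing.isSubringClosed.Build {fraction {poly int}} is_laurent is_laurent_subring.

Record laurentZ : Type :=
  LaurentZ { laurent_val :> {fraction {poly int}}; _ : laurent_val \in is_laurent }.

HB.instance Definition _ := [isSub for laurent_val].
HB.instance Definition _ := [Choice of laurentZ by <:].
HB.instance Definition _ := [SubChoice_isSubComNzRing of laurentZ by <:].

Fact laurent_v_proof : tofrac 'X \in is_laurent.
Proof. by apply/asboolP; exists 'X, 0%N; rewrite mulr1. Qed.

Definition laurent_v : laurentZ := LaurentZ laurent_v_proof.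

Fact laurent_vV_proof : (tofrac 'X)^-1 \in is_laurent.
Proof.
apply/asboolP; exists 1, 1%N.
by rewrite expr1 mulVf ?tofrac1 // tofrac_eq0 polyX_eq0.
Qed.

Definition laurent_vV : laurentZ := LaurentZ laurent_vV_proof.

Lemma laurent_vVK : laurent_v * laurent_vV = 1.
Proof. by apply/val_inj; rewrite /= mulfV // tofrac_eq0 polyX_eq0. Qed.

(** Finite sets with a left action of a finite group (the actions of
    fingroup/action.v are right actions). *)

Record gset (gT : finGroupType) := GSet {
  gcar :> finType;
  gact : gT -> gcar -> gcar;
  gact1 : forall x, gact 1%g x = x;
  gactM : forall a b x, gact (a * b)%g x = gact a (gact b x) }.

Section InvariantFunctions.
Variables (R : comNzRingType) (gT : finGroupType).
Implicit Types S T U W : gset gT.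

Definition invariant S T (h : {ffun S * T -> R^o}) : bool :=
  [forall g, forall s, forall t, h (gact g s, gact g t) == h (s, t)].

Record invfun S T : Type :=
  InvFun { invfun_val : {ffun S * T -> R^o}; _ : invariant invfun_val }.

HB.instance Definition _ S T := [isSub for @invfun_val S T].
HB.instance Definition _ S T := [Choice of invfun S T by <:].

Lemma invariantP S T (h : {ffun S * T -> R^o}) :
  reflect (forall g s t, h (gact g s, gact g t) = h (s, t)) (invariant h).
Proof.
apply: (iffP forallP) => [H g s t|H g].
  by move/(_ g)/forallP/(_ s)/forallP/(_ t)/eqP: H.
by apply/forallP => s; apply/forallP => t; apply/eqP.
Qed.

Fact invariant_submod S T : submod_closed (@invariant S T).
Proof.
split=> [|a h k /invariantP hP /invariantP kP].
  by apply/invariantP => g s t; rewrite !ffunE.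
by apply/invariantP => g s t; rewrite !ffunE hP kP.
Qed.

HB.instance Definition _ S T :=
  GRing.isSubmodClosed.Build R {ffun S * T -> R^o} (@invariant S T)
    (@invariant_submod S T).
HB.instance Definition _ S T := [SubChoice_isSubLmodule of invfun S T by <:].

Lemma gact_bij S (g : gT) : bijective (@gact gT S g).
Proof.
by exists (gact g^-1%g) => x; rewrite -gactM ?mulVg ?mulgV gact1.
Qed.

Definition conv_fun S T U (h : invfun S T) (k : invfun T U) :
    {ffun S * U -> R^o} :=
  [ffun p => \sum_(t : T)
     (invfun_val h (p.1, t) : R) * (invfun_val k (t, p.2) : R)].

Fact conv_subproof S T U (h : invfun S T) (k : invfun T U) :
  invariant (conv_fun h k).
Proof.
apply/invariantP => g s u; rewrite !ffunE /=.
rewrite (reindex (gact g)); last exact/onW_bij/gact_bij.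
case: h k => [h /invariantP hP] [k /invariantP kP] /=.
by apply: eq_bigr => t _; rewrite hP kP.
Qed.

Definition conv S T U (h : invfun S T) (k : invfun T U) : invfun S U :=
  InvFun (conv_subproof h k).

Lemma convE S T U (h : invfun S T) (k : invfun T U) s u :
  invfun_val (conv h k) (s, u) =
  \sum_(t : T) (invfun_val h (s, t) : R) * (invfun_val k (t, u) : R).
Proof. by rewrite ffunE. Qed.

Lemma invfunP S T (h k : invfun S T) :
  (forall s t, invfun_val h (s, t) = invfun_val k (s, t)) <-> h = k.
Proof.
by split=> [H|-> //]; apply/val_inj/ffunP => -[s t]; exact: H.
Qed.

Definition diag_fun S : {ffun S * S -> R^o} := [ffun p => (p.1 == p.2)%:R].

Fact diag_subproof S : invariant (diag_fun S).
Proof.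
apply/invariantP => g s t; rewrite !ffunE /=.
by rewrite (inj_eq (bij_inj (gact_bij _ _))).
Qed.

Definition diag S : invfun S S := InvFun (diag_subproof S).

Lemma convA S T U W (h : invfun S T) (k : invfun T U) (l : invfun U W) :
  conv h (conv k l) = conv (conv h k) l.
Proof.
apply/invfunP => s w; rewrite !convE.
under eq_bigr do rewrite convE mulr_sumr.
under [RHS]eq_bigr do rewrite convE mulr_suml.
rewrite exchange_big /=; apply: eq_bigr => u _.
by apply: eq_bigr => t _; rewrite mulrA.
Qed.

Lemma conv1l S T (h : invfun S T) : conv (diag S) h = h.
Proof.
apply/invfunP => s t; rewrite convE (bigD1 s) //= ffunE eqxx mul1r big1 ?addr0 //.
by move=> u /negPf us; rewrite ffunE /= eq_sym us mul0r.
Qed.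

Lemma conv1r S T (h : invfun S T) : conv h (diag T) = h.
Proof.
apply/invfunP => s t; rewrite convE (bigD1 t) //= ffunE eqxx mulr1 big1 ?addr0 //.
by move=> u /negPf us; rewrite ffunE /= us mulr0.
Qed.

Lemma convDl S T U (h k : invfun S T) (l : invfun T U) :
  conv (h + k) l = conv h l + conv k l.
Proof.
apply/invfunP => s u; rewrite !(convE, ffunE) /= -big_split /=.
by apply: eq_bigr => t _; rewrite ffunE mulrDl.
Qed.

Lemma convDr S T U (h : invfun S T) (k l : invfun T U) :
  conv h (k + l) = conv h k + conv h l.
Proof.
apply/invfunP => s u; rewrite !(convE, ffunE) /= -big_split /=.
by apply: eq_bigr => t _; rewrite ffunE mulrDr.
Qed.

Lemma convZl S T U a (h : invfun S T) (k : invfun T U) :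
  conv (a *: h) k = a *: conv h k.
Proof.
apply/invfunP => s u; rewrite !(convE, ffunE) /= scaler_sumr.
by apply: eq_bigr => t _; rewrite ffunE -mulrA.
Qed.

Lemma convZr S T U a (h : invfun S T) (k : invfun T U) :
  conv h (a *: k) = a *: conv h k.
Proof.
apply/invfunP => s u; rewrite !(convE, ffunE) /= scaler_sumr.
by apply: eq_bigr => t _; rewrite ffunE mulrCA.
Qed.

(** The convolution algebra of invariant functions on S x S.  It is only a
    pzRingType, and not an algType, because S may be empty; [convZl] and
    [convZr] are the remaining axioms of an R-algebra. *)
Definition convalg S : Type := invfun S S.

HB.instance Definition _ S := GRing.Lmodule.on (convalg S).
HB.instance Definition _ S := GRing.Zmodule_isPzRing.Build (convalg S)
  (@convA S S S S) (@conv1l S S) (@conv1r S S) (@convDl S S S) (@convDr S S S).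

End InvariantFunctions.

Section ModuleEndomorphisms.
Variables (R : comNzRingType) (V : lmodType R) (B : Type).
Variable act : B -> {linear V -> V}.

Definition is_endo : pred (V -> V) :=
  fun f => `[< linear f /\ forall b x, f (act b x) = act b (f x) >].

(** The R-linear endomorphisms of V which commute with all the operators
    [act b]; the product is composition. *)
Record endo : Type := Endo { endo_val :> V -> V; _ : is_endo endo_val }.

HB.instance Definition _ := [isSub for endo_val].
HB.instance Definition _ := [Choice of endo by <:].

Lemma is_endoP (f : V -> V) :
  reflect (linear f /\ forall b x, f (act b x) = act b (f x)) (is_endo f).
Proof. exact: asboolP. Qed.

Fact is_endo_submod : submod_closed is_endo.
Proof.
split=> [|a f g /is_endoP[fL fB] /is_endoP[gL gB]]; apply/is_endoP; split.
- by move=> c x y; rewrite /= scaler0 addr0.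
- by move=> b x; rewrite linear0.
- move=> c x y; rewrite !fctE fL gL !scalerDr !scalerA [c * a]mulrC.
  by rewrite addrACA.
- by move=> b x; rewrite !fctE fB gB linearP.
Qed.

HB.instance Definition _ :=
  GRing.isSubmodClosed.Build R (V -> V) is_endo is_endo_submod.
HB.instance Definition _ := [SubChoice_isSubLmodule of endo by <:].

Lemma endoP (f g : endo) : f =1 g <-> f = g.
Proof. by split=> [H|-> //]; apply/val_inj/funext. Qed.

Fact endo_one_subproof : is_endo idfun.
Proof. exact/is_endoP. Qed.

Definition endo_one : endo := Endo endo_one_subproof.

Fact endo_mul_subproof (f g : endo) : is_endo (f \o g).
Proof.
case: f g => [f /is_endoP[fL fB]] [g /is_endoP[gL gB]] /=.
apply/is_endoP; split=> [c x y|b x] /=; first by rewrite gL fL.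
by rewrite gB fB.
Qed.

Definition endo_mul (f g : endo) : endo := Endo (endo_mul_subproof f g).

Fact endo_mulA : associative endo_mul.
Proof. by move=> f g h; apply/endoP. Qed.

Fact endo_mul1l : left_id endo_one endo_mul.
Proof. by move=> f; apply/endoP. Qed.

Fact endo_mul1r : right_id endo_one endo_mul.
Proof. by move=> f; apply/endoP. Qed.

Fact endo_mulDl : left_distributive endo_mul +%R.
Proof. by move=> f g h; apply/endoP. Qed.

Fact endo_mulDr : right_distributive endo_mul +%R.
Proof.
move=> [f fE] g h; apply/endoP => x /=; have /is_endoP[fL _] := fE.
by have := fL 1 (g x) (h x); rewrite !scale1r.
Qed.

HB.instance Definition _ := GRing.Zmodule_isPzRing.Build endo
  endo_mulA endo_mul1l endo_mul1r endo_mulDl endo_mulDr.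

Lemma endo_mulE (f g : endo) x : (f * g) x = f (g x).
Proof. by []. Qed.

End ModuleEndomorphisms.

Section Actions.
Variables (R : comNzRingType) (gT : finGroupType) (S T : gset gT).

(** [invfun R S T] is a left module over [convalg R S] through [lconv], and a
    right module over [convalg R T] through [rconv]. *)
Definition lconv (a : convalg R S) (x : invfun R S T) : invfun R S T :=
  conv a x.
Definition rconv (b : convalg R T) (x : invfun R S T) : invfun R S T :=
  conv x b.

Fact lconv_linear a : linear (lconv a).
Proof. by move=> c x y; rewrite /lconv convDr convZr. Qed.

Fact rconv_linear b : linear (rconv b).
Proof. by move=> c x y; rewrite /rconv convDl convZl. Qed.

HB.instance Definition _ a :=
  GRing.isLinear.Build R (invfun R S T) (invfun R S T) *:%R (lconv a)
    (lconv_linear a).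
HB.instance Definition _ b :=
  GRing.isLinear.Build R (invfun R S T) (invfun R S T) *:%R (rconv b)
    (rconv_linear b).

End Actions.

Section AffineGroup.
Variables (F : finFieldType) (d : nat).

Record GL := MkGL { GL_mx :> 'M[F]_d; GL_unit : GL_mx \in unitmx }.

HB.instance Definition _ := [isSub for GL_mx].
HB.instance Definition _ := [Finite of GL by <:].

(** The semidirect product of the column vectors F^d by GL_d(F); the pair
    (w, g) stands for the affine transformation x |-> g x + w. *)
Definition affgrp : Type := ('cV[F]_d * GL)%type.

HB.instance Definition _ := Finite.on affgrp.

Definition GL_one : GL := MkGL (unitmx1 F d).

Fact GL_mul_subproof (a b : GL) : GL_mx a *m GL_mx b \in unitmx.
Proof. by rewrite unitmx_mul !GL_unit. Qed.

Definition GL_mul (a b : GL) : GL := MkGL (GL_mul_subproof a b).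

Fact GL_inv_subproof (a : GL) : invmx a \in unitmx.
Proof. by rewrite unitmx_inv GL_unit. Qed.

Definition GL_inv (a : GL) : GL := MkGL (GL_inv_subproof a).

Definition affgrp_one : affgrp := (0, GL_one).
Definition affgrp_mul (a b : affgrp) : affgrp :=
  (a.1 + a.2 *m b.1, GL_mul a.2 b.2).
Definition affgrp_inv (a : affgrp) : affgrp :=
  (- (invmx a.2 *m a.1), GL_inv a.2).

Fact affgrp_mulA : associative affgrp_mul.
Proof.
move=> a b c; congr pair; last by apply/val_inj; rewrite /= mulmxA.
by rewrite /= mulmxDr addrA mulmxA.
Qed.

Fact affgrp_mul1l : left_id affgrp_one affgrp_mul.
Proof.
move=> [w g]; congr pair; last by apply/val_inj; rewrite /= mul1mx.
by rewrite /= mul1mx add0r.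
Qed.

Fact affgrp_mul1r : right_id affgrp_one affgrp_mul.
Proof.
move=> [w g]; congr pair; last by apply/val_inj; rewrite /= mulmx1.
by rewrite /= mulmx0 addr0.
Qed.

Fact affgrp_mulV : left_inverse affgrp_one affgrp_inv affgrp_mul.
Proof.
move=> [w g]; congr pair; first by rewrite /= addNr.
by apply/val_inj; rewrite /= mulVmx ?GL_unit.
Qed.

Fact affgrp_mulrV : right_inverse affgrp_one affgrp_inv affgrp_mul.
Proof.
move=> [w g]; congr pair; first by rewrite /= mulmxN mulKVmx ?GL_unit ?subrr.
by apply/val_inj; rewrite /= mulmxV ?GL_unit.
Qed.

HB.instance Definition _ := isGroup.Build affgrp
  affgrp_mulA affgrp_mul1l affgrp_mul1r affgrp_mulV affgrp_mulrV.

End AffineGroup.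

Section FiniteVspace.
Import VectorInternalTheory.
Variables (F : finFieldType) (V : vectType F).

HB.instance Definition _ := [Countable of {vspace V} by <:].
HB.instance Definition _ := [Finite of {vspace V} by <:].

End FiniteVspace.

Section Flags.
Variables (F : finFieldType) (d : nat).
Local Notation V := 'cV[F]_d.

Definition is_flag n (f : {ffun 'I_n.+1 -> {vspace V}}) : bool :=
  [&& f ord0 == 0%VS, f ord_max == fullv
    & [forall i : 'I_n.+1, forall j : 'I_n.+1, (i <= j)%N ==> (f i <= f j)%VS]].

Record flag n : Type :=
  Flag { flag_val :> {ffun 'I_n.+1 -> {vspace V}}; _ : is_flag flag_val }.

HB.instance Definition _ n := [isSub for @flag_val n].
HB.instance Definition _ n := [Finite of flag n by <:].

Definition is_complete_flag (f : flag d) : bool :=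
  [forall i : 'I_d.+1, \dim (f i) == i].

Record cflag : Type :=
  CFlag { cflag_val :> flag d; _ : is_complete_flag cflag_val }.

HB.instance Definition _ := [isSub for cflag_val].
HB.instance Definition _ := [Finite of cflag by <:].

Definition GL_linfun (g : GL F d) : 'End(V) := linfun (mulmx g).

Lemma GL_linfunE g v : GL_linfun g v = g *m v.
Proof. by rewrite lfunE. Qed.

Lemma GL_linfun1 : GL_linfun (GL_one F d) = \1%VF.
Proof. by apply/lfunP => v; rewrite GL_linfunE id_lfunE mul1mx. Qed.

Lemma GL_linfunM a b : GL_linfun (GL_mul a b) = (GL_linfun a \o GL_linfun b)%VF.
Proof. by apply/lfunP => v; rewrite comp_lfunE !GL_linfunE mulmxA. Qed.

Lemma lker0_GL_linfun g : lker (GL_linfun g) == 0%VS.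
Proof.
apply/lker0P => u v; rewrite !GL_linfunE => /(congr1 (mulmx (invmx g))).
by rewrite !mulKmx ?GL_unit.
Qed.

Lemma dim_GL_linfun g (U : {vspace V}) : \dim (GL_linfun g @: U) = \dim U.
Proof.
by apply/limg_dim_eq; rewrite (eqP (lker0_GL_linfun g)) capv0.
Qed.

Fact flag_act_subproof n (g : GL F d) (f : flag n) :
  is_flag [ffun i => (GL_linfun g @: f i)%VS].
Proof.
case: f => f /= /and3P[/eqP f0 /eqP f1 /forallP fle]; apply/and3P; split.
- by rewrite ffunE f0 limg0.
- by rewrite ffunE f1 eqEdim subvf dim_GL_linfun /=.
- apply/forallP => i; apply/forallP => j; apply/implyP => ij; rewrite !ffunE.
  by apply: limgS; have /forallP/(_ j)/implyP := fle i; apply.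
Qed.

Definition flag_act n (g : GL F d) (f : flag n) : flag n :=
  Flag (flag_act_subproof g f).

Fact cflag_act_subproof (g : GL F d) (f : cflag) :
  is_complete_flag (flag_act g f).
Proof.
case: f => f /= /forallP fd; apply/forallP => i.
by rewrite /= ffunE dim_GL_linfun.
Qed.

Definition cflag_act (g : GL F d) (f : cflag) : cflag :=
  CFlag (cflag_act_subproof g f).

Lemma flag_act1 n (f : flag n) : flag_act (GL_one F d) f = f.
Proof.
by apply/val_inj/ffunP => i; rewrite /= ffunE GL_linfun1 lim1g.
Qed.

Lemma flag_actM n a b (f : flag n) :
  flag_act (GL_mul a b) f = flag_act a (flag_act b f).
Proof.
by apply/val_inj/ffunP => i; rewrite /= !ffunE GL_linfunM limg_comp.
Qed.

Lemma cflag_act1 (f : cflag) : cflag_act (GL_one F d) f = f.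
Proof. by apply/val_inj; rewrite /= flag_act1. Qed.

Lemma cflag_actM a b (f : cflag) :
  cflag_act (GL_mul a b) f = cflag_act a (cflag_act b f).
Proof. by apply/val_inj; rewrite /= flag_actM. Qed.

Definition X_act n (a : affgrp F d) (p : flag n * V) : flag n * V :=
  (flag_act a.2 p.1, a.2 *m p.2 + a.1).

Definition Y_act (a : affgrp F d) (p : cflag * V) : cflag * V :=
  (cflag_act a.2 p.1, a.2 *m p.2 + a.1).

Fact X_act1 n p : @X_act n 1%g p = p.
Proof. by case: p => f w; rewrite /X_act /= flag_act1 mul1mx addr0. Qed.

Fact X_actM n a b p : @X_act n (a * b)%g p = X_act a (X_act b p).
Proof.
rewrite /X_act /= flag_actM mulmxDr -addrA mulmxA.
by congr (_, _ + _); rewrite addrC.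
Qed.

Fact Y_act1 p : Y_act 1%g p = p.
Proof. by case: p => f w; rewrite /Y_act /= cflag_act1 mul1mx addr0. Qed.

Fact Y_actM a b p : Y_act (a * b)%g p = Y_act a (Y_act b p).
Proof.
rewrite /Y_act /= cflag_actM mulmxDr -addrA mulmxA.
by congr (_, _ + _); rewrite addrC.
Qed.

Definition Xset n : gset (affgrp F d) := GSet (@X_act1 n) (@X_actM n).
Definition Yset : gset (affgrp F d) := GSet Y_act1 Y_actM.

Definition MS n := convalg laurentZ (Xset n).
Definition MH := convalg laurentZ Yset.
Definition MV n := invfun laurentZ (Xset n) Yset.

HB.instance Definition _ n := GRing.PzRing.on (MS n).
HB.instance Definition _ n := GRing.Lmodule.on (MS n).
HB.instance Definition _ := GRing.PzRing.on MH.
HB.instance Definition _ := GRing.Lmodule.on MH.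
HB.instance Definition _ n := GRing.Lmodule.on (MV n).

(** In both algebras the endomorphisms are written on the left of their
    argument, so that right multiplication by MH is an anti-morphism from MH
    to [End_MS n]. *)
Definition End_MH n : Type :=
  endo (fun b : MH => (rconv b : {linear MV n -> MV n})).
Definition End_MS n : Type :=
  endo (fun a : MS n => (lconv a : {linear MV n -> MV n})).

HB.instance Definition _ n := GRing.PzRing.on (End_MH n).
HB.instance Definition _ n := GRing.Lmodule.on (End_MH n).
HB.instance Definition _ n := GRing.PzRing.on (End_MS n).
HB.instance Definition _ n := GRing.Lmodule.on (End_MS n).

End Flags.

(* Main.v *)
From HB Require Import structures.
From mathcomp Require Import all_boot all_algebra fingroup.
From mathcomp Require Import boolp.
Require Import Defs.

Set Implicit Arguments.
Unset Strict Implicit.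
Unset Printing Implicit Defensive.

Import GRing.Theory.
Local Open Scope ring_scope.

(** Both halves hold for finite sets X, Y with an action of a finite group,
    and rest on the graphs of equivariant maps u : Y -> X.  Write [u] for the
    invariant function on X x Y equal to 1 at the pairs (u y, y) and to 0
    elsewhere.  Convolution by [u] evaluates: (h * [u])(x, y) = h(x, u y).

    Commutant of the left action.  If u is injective, the functions on X x X
    supported in X x u(Y) recover all of MV: each x in MV is a * [u] for some
    a in MS.  An MS-linear f is therefore determined by f[u], and f turns out
    to be right convolution by k(y, z) = (f[u])(u y, z)
    ([lconv_commutant]).

    Commutant of the right action.  Take a family of equivariant maps u_i whose
    images cover X.  If f is given by left convolution by h, then
    h(p', u_i y) = (f[u_i])(p', y), so this formula must be used to define h.
    What has to be checked is that the right-hand side depends on the point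
    u_i y alone, and that the functions [u_i] generate MV under MH.  Both are
    true after multiplication by a positive integer: summing over the fibre of
    u_i is right convolution by an element of MH, hence commutes with f, and
    multiplies by the cardinality of the fibre ([fiber_average],
    [graph_span]).  As MV has no integer torsion, these integers cancel
    ([endo_graph_eq], [endo_graph_ext]), and h has its values in the coefficient
    ring with no division ([rconv_commutant]).

    For flags, the equivariant maps Y -> X needed here select members of a
    complete flag by a monotone map of indices ([coarsen]).  Every flag f is obtained from a
    complete refinement by the index map i |-> dim f_i
    ([complete_refinement]), which gives the covering family.  When d <= n the
    index map i |-> min i d forgets nothing, which gives the injective map. *)

(** * Invariant functions and graphs of equivariant maps *)

Section InvariantKernels.
Variables (R : comNzRingType) (gT : finGroupType).

Fact kernel_subproof (S T : gset gT) (k : S -> T -> R)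
    (kG : forall g s t, k (gact g s) (gact g t) = k s t) :
  invariant ([ffun p => k p.1 p.2] : {ffun S * T -> R^o}).
Proof. by apply/invariantP => g s t; rewrite !ffunE kG. Qed.

(** Locked, since otherwise simplification would replace the values of a kernel
    by those of the underlying finite function. *)
Definition kernel (S T : gset gT) (k : S -> T -> R)
    (kG : forall g s t, k (gact g s) (gact g t) = k s t) : invfun R S T :=
  locked (InvFun (kernel_subproof kG)).

Lemma kernelE (S T : gset gT) (k : S -> T -> R) kG s t :
  invfun_val (@kernel S T k kG) (s, t) = k s t.
Proof. by rewrite /kernel -lock ffunE. Qed.

Lemma invfunG (S T : gset gT) (h : invfun R S T) g s t :
  invfun_val h (gact g s, gact g t) = invfun_val h (s, t).
Proof. by case: h => h hP; have /invariantP := hP; apply. Qed.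

Lemma invfun_valD (S T : gset gT) (h k : invfun R S T) p :
  invfun_val (h + k) p = invfun_val h p + invfun_val k p.
Proof. by rewrite ffunE. Qed.

Lemma invfun_valZ (S T : gset gT) a (h : invfun R S T) p :
  invfun_val (a *: h) p = a * (invfun_val h p : R).
Proof. by rewrite ffunE. Qed.

Lemma invfun_val_sum (S T : gset gT) (I : finType) (h : I -> invfun R S T) p :
  invfun_val (\sum_i h i) p = \sum_i (invfun_val (h i) p : R).
Proof.
elim/big_rec2: _ => [|i y x _ <-]; first by rewrite ffunE.
by rewrite invfun_valD.
Qed.

Variables X Y : gset gT.

Definition equivariant (u : Y -> X) : Prop :=
  forall g y, u (gact g y) = gact g (u y).

Lemma gact_inj (S : gset gT) (g : gT) : injective (@gact gT S g).
Proof. exact: bij_inj (gact_bij S g). Qed.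

Lemma graph_subproof (u : Y -> X) (uG : equivariant u) g x y :
  (gact g x == u (gact g y))%:R = (x == u y)%:R :> R.
Proof. by rewrite uG (inj_eq (@gact_inj X g)). Qed.

Definition graph (u : Y -> X) (uG : equivariant u) : invfun R X Y :=
  kernel (graph_subproof uG).

Lemma graphE u (uG : equivariant u) x y : invfun_val (graph uG) (x, y) = (x == u y)%:R.
Proof. exact: kernelE. Qed.

Lemma conv_graph (h : invfun R X X) u (uG : equivariant u) x y :
  invfun_val (conv h (graph uG)) (x, y) = invfun_val h (x, u y).
Proof.
rewrite convE (bigD1 (u y)) //= graphE eqxx mulr1 big1 ?addr0 // => z /negPf zu.
by rewrite graphE zu mulr0.
Qed.

Lemma graph_conv u (uG : equivariant u) (k : invfun R Y Y) x y :
  invfun_val (conv (graph uG) k) (x, y)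
  = \sum_(t | u t == x) (invfun_val k (t, y) : R).
Proof.
rewrite convE [RHS]big_mkcond; apply: eq_bigr => t _.
by rewrite graphE eq_sym; case: eqP; rewrite ?mul1r ?mul0r.
Qed.

End InvariantKernels.

Arguments graph {R gT X Y u} uG.
Arguments kernel {R gT S T} k kG.

(** * The commutant of the left action *)

Section CommutantOfLeftAction.
Variables (R : comNzRingType) (gT : finGroupType) (X Y : gset gT).
Local Notation M := (invfun R X Y).
Variable f : M -> M.
Hypothesis f_lconv : forall (a : convalg R X) x, f (lconv a x) = lconv a (f x).

Variables (u : Y -> X) (uG : equivariant u) (u_inj : injective u).

(** The graph of u generates MV under MS: x = a * graph u, where a is x carried
    to X x u(Y) and extended by 0.  So f x = a * f (graph u). *)
Lemma lconv_commutant :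
  exists k : convalg R Y, forall x, f x = conv x k.
Proof.
have kG g y z : invfun_val (f (graph uG)) (u (gact g y), gact g z)
              = invfun_val (f (graph uG)) (u y, z) :> R.
  by rewrite uG invfunG.
exists (kernel (fun y z => invfun_val (f (graph uG)) (u y, z) : R) kG) => x.
(* As u is injective, the sum over the fibre of u is the value of x at the
   preimage of p' if there is one, and 0 otherwise. *)
have aG g p p' :
    \sum_(y | u y == gact g p') (invfun_val x (gact g p, y) : R)
  = \sum_(y | u y == p') (invfun_val x (p, y) : R).
  rewrite (reindex (gact g)) /=; last exact/onW_bij/gact_bij.
  apply: eq_big => y; first by rewrite uG (inj_eq (@gact_inj _ X g)).
  by rewrite invfunG.
pose a := kernel
  (fun p p' => \sum_(y | u y == p') (invfun_val x (p, y) : R)) aG.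
have -> : f x = lconv a (f (graph uG)).
  rewrite -f_lconv; congr f; apply/invfunP => p y.
  rewrite conv_graph kernelE (big_pred1 y) // => z.
  by rewrite (inj_eq u_inj).
apply/invfunP => p y; rewrite !convE.
under eq_bigr do rewrite kernelE mulr_suml.
rewrite (exchange_big_dep xpredT) //=; apply: eq_bigr => z _.
by rewrite kernelE (big_pred1 (u z)).
Qed.

(** As u is injective, k is the restriction of graph u * k to u(Y) x Y. *)
Lemma conv_injr (k k' : convalg R Y) :
  (forall x : M, conv x k = conv x k') -> k = k'.
Proof.
move=> kk'; apply/invfunP => y z.
have /invfunP/(_ (u y) z) := kk' (graph uG).
by rewrite !graph_conv !(big_pred1 y) // => t; rewrite (inj_eq u_inj).
Qed.

End CommutantOfLeftAction.

(** * The commutant of the right action *)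

Section CommutantOfRightAction.
Variables (R : comNzRingType) (gT : finGroupType) (X Y : gset gT).
Hypothesis natr_cancel : forall m, (0 < m)%N -> GRing.lreg (m%:R : R).
Local Notation M := (invfun R X Y).

Variables (I : finType) (u : I -> Y -> X).
Hypothesis uG : forall i, equivariant (u i).
Hypothesis u_cover : forall p, exists i y, u i y = p.

Let fib (i : I) (p : X) : nat := #|[pred y | u i y == p]|.

Lemma fibG i g p : fib i (gact g p) = fib i p.
Proof.
rewrite /fib -!sum1_card (reindex (gact g)) /=; last exact/onW_bij/gact_bij.
by apply: eq_bigl => y; rewrite !inE uG (inj_eq (@gact_inj _ X g)).
Qed.

Section Values.
Variable f : M -> M.
Hypothesis f_rconv : forall (b : convalg R Y) x, f (rconv b x) = rconv b (f x).

(** In the module MV one has graph u_i * b = graph u_j * D, where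
    b(t, z) = [u_i t = u_j z] and D is diagonal with entries the cardinalities
    of the fibres of u_i over the points u_j z: both sides count, at (q, z),
    the t with u_i t = q = u_j z.  Applying f to this relation gives the
    formula. *)
Lemma fiber_average i j p y :
  (fib i (u j y))%:R * (invfun_val (f (graph (uG j))) (p, y) : R)
  = \sum_(t | u i t == u j y) (invfun_val (f (graph (uG i))) (p, t) : R).
Proof.
have bG g t z : (u i (gact g t) == u j (gact g z))%:R = (u i t == u j z)%:R :> R.
  by rewrite !uG (inj_eq (@gact_inj _ X g)).
have dG g t z : ((gact g t == gact g z) * fib i (u j (gact g z)))%:R
             = ((t == z) * fib i (u j z))%:R :> R.
  by rewrite (inj_eq (@gact_inj _ Y g)) uG fibG.
have bd : rconv (kernel _ bG) (graph (uG i)) = rconv (kernel _ dG) (graph (uG j)).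
  apply/invfunP => q z; rewrite !graph_conv.
  under eq_bigr do rewrite kernelE.
  under [RHS]eq_bigr do rewrite kernelE.
  transitivity (((q == u j z) * fib i (u j z))%:R : R).
    have [->|qz] := eqVneq q (u j z).
      rewrite mul1n /fib -sum1_card natr_sum.
      by apply: eq_bigr => t ->.
    by apply: big1 => t /eqP->; rewrite (negPf qz).
  rewrite big_mkcond (bigD1 z) //= big1 ?addr0 => [|t /negPf->]; last first.
    by rewrite mul0n if_same.
  by rewrite eqxx mul1n eq_sym; case: eqP; rewrite ?mul1n.
have := congr1 f (esym bd); rewrite !f_rconv => /invfunP/(_ p y).
rewrite !convE (bigD1 y) //= [X in _ + X]big1 => [|t /negPf ty]; last first.
  by rewrite kernelE ty mul0n mulr0.
rewrite kernelE eqxx mul1n addr0 mulrC => ->; rewrite [RHS]big_mkcond /=.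
apply: eq_bigr => t _; rewrite kernelE.
by case: eqP => _; rewrite ?mulr1 ?mulr0.
Qed.

(** By [fiber_average], both values are the mean of f (graph u_i) over the same
    fibre; for the left one, take j = i there. *)
Lemma endo_graph_eq i j p t y : u i t = u j y ->
  invfun_val (f (graph (uG i))) (p, t) = invfun_val (f (graph (uG j))) (p, y).
Proof.
move=> tu; have fib_gt0 : (0 < fib i (u i t))%N.
  by apply/card_gt0P; exists t; rewrite inE.
have := fiber_average i i p t; rewrite tu -fiber_average -tu.
exact: natr_cancel fib_gt0 _ _.
Qed.
End Values.

Let mult (p : X) : nat := (\sum_i fib i p)%N.

Lemma multG g p : mult (gact g p) = mult p.
Proof. by apply: eq_bigr => i _; rewrite fibG. Qed.

Lemma mult_gt0 p : (0 < mult p)%N.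
Proof.
have [i [y uy]] := u_cover p; rewrite /mult (bigD1 i) //= addn_gt0.
by apply/orP; left; apply/card_gt0P; exists y; rewrite inE uy.
Qed.

(** Since graph u_i * c (p, z) is the sum of c(y, z) over the fibre of u_i over
    p, the choice c_i(y, z) = x(u_i y, z) makes the sum over i equal to
    mult p * x(p, z).  The factor mult p varies with p; weighting c_i by
    C / mult (u_i y) for a common multiple C turns it into the constant C. *)
Lemma graph_span :
  exists2 C, (0 < C)%N & forall x : M, exists c : I -> convalg R Y,
    C%:R *: x = \sum_i rconv (c i) (graph (uG i)).
Proof.
pose C := (\prod_p mult p)%N.
have mult_dvd p : (mult p %| C)%N by rewrite /C (bigD1 p) //= dvdn_mulr.
exists C => [|x]; first by apply: prodn_gt0 => p; apply: mult_gt0.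
have cG i g y z :
    (C %/ mult (u i (gact g y)))%:R
      * (invfun_val x (u i (gact g y), gact g z) : R)
  = (C %/ mult (u i y))%:R * (invfun_val x (u i y, z) : R).
  by rewrite uG multG invfunG.
exists (fun i => kernel _ (cG i)); apply/invfunP => p z.
rewrite invfun_valZ invfun_val_sum /=.
rewrite [RHS](eq_bigr (fun i => (fib i p)%:R
    * ((C %/ mult p)%:R * (invfun_val x (p, z) : R)))) => [|i _].
  by rewrite -mulr_suml -natr_sum mulrA -natrM mulnC divnK.
rewrite graph_conv (eq_bigr (fun=> (C %/ mult p)%:R * (invfun_val x (p, z) : R))).
  by rewrite sumr_const [RHS]mulr_natl.
by move=> t /eqP tp; rewrite kernelE tp.
Qed.

Lemma endo_graph_ext (f f' : {linear M -> M}) :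
    (forall (b : convalg R Y) x, f (rconv b x) = rconv b (f x)) ->
    (forall (b : convalg R Y) x, f' (rconv b x) = rconv b (f' x)) ->
  (forall i, f (graph (uG i)) = f' (graph (uG i))) -> f =1 f'.
Proof.
move=> f_rconv f'_rconv ff' x; have [C C_gt0 /(_ x)[c xc]] := graph_span.
have {xc} fxC : C%:R *: f x = C%:R *: f' x.
  rewrite -!linearZ xc !linear_sum; apply: eq_bigr => i _.
  by rewrite f_rconv f'_rconv ff'.
apply/invfunP => p y; apply: (natr_cancel C_gt0).
by have /invfunP/(_ p y) := fxC; rewrite !invfun_valZ.
Qed.

(** The values of h are read off from the graphs through a choice, for each p,
    of an index i and a point y over p; [endo_graph_eq] makes the result
    independent of this choice, hence invariant. *)
Lemma rconv_commutant (f : {linear M -> M}) :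
    (forall (b : convalg R Y) x, f (rconv b x) = rconv b (f x)) ->
  exists h : convalg R X, forall x, f x = conv h x.
Proof.
move=> f_rconv.
have /fin_all_exists[i /fin_all_exists[y uy]] := u_cover.
have hG g p' p :
    (invfun_val (f (graph (uG (i (gact g p))))) (gact g p', y (gact g p)) : R)
  = (invfun_val (f (graph (uG (i p)))) (p', y p) : R).
  rewrite -(invfunG _ g _ (y p)); apply: (endo_graph_eq f_rconv).
  by rewrite uy uG uy.
pose h : convalg R X := kernel _ hG; exists h => x.
rewrite -/(lconv h x); apply: endo_graph_ext => // [b z|j].
  by rewrite /= /lconv /rconv convA.
apply/invfunP => p z; rewrite conv_graph kernelE.
by apply: (endo_graph_eq f_rconv); rewrite uy.
Qed.

(** Left convolution by h sends the graph of u_i to (p', y) |-> h(p', u_i y). *)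
Lemma conv_injl (h h' : convalg R X) :
  (forall x : M, conv h x = conv h' x) -> h = h'.
Proof.
move=> hh'; apply/invfunP => p' p; have [i [y <-]] := u_cover p.
by rewrite -!(conv_graph _ (uG i)) hh'.
Qed.
End CommutantOfRightAction.

(** * Complete flags and their coarsenings *)

Section Flags.
Variables (F : finFieldType) (d : nat).

Lemma dim_cV : \dim {: 'cV[F]_d} = d.
Proof. by rewrite dimvf /dim /= muln1. Qed.

(** A basis of U m starting with bases of all the earlier U i is built by
    appending a basis of a complement at each step. *)
Lemma adapted_basis (V : vectType F) (U : nat -> {vspace V}) :
    (forall m, (U m <= U m.+1)%VS) ->
  forall m, exists2 b : seq V, basis_of (U m) b
    & forall i, (i <= m)%N -> <<take (\dim (U i)) b>>%VS = U i.
Proof.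
move=> Ule; elim=> [|m [b bU bt]].
  exists (vbasis (U 0)) => [|i]; first exact: vbasisP.
  rewrite leqn0 => /eqP->; rewrite take_oversize ?size_tuple //.
  exact: span_basis (vbasisP _).
have Um1 : (U m + (U m.+1 :\: U m) = U m.+1)%VS.
  by rewrite addvC; have := addv_diff (U m.+1) (U m); rewrite (addv_idPl (Ule m)).
have size_b : size b = \dim (U m) by rewrite (size_basis (X := in_tuple b) bU).
have bm1 : basis_of (U m.+1) (b ++ vbasis (U m.+1 :\: U m)%VS).
  rewrite -[X in basis_of X]Um1; apply: cat_basis => //; last exact: vbasisP.
  by apply/directv_addP; rewrite capvC capv_diff.
exists (b ++ vbasis (U m.+1 :\: U m)%VS) => // i.
rewrite leq_eqVlt => /predU1P[->|im].
  rewrite take_oversize ?(span_basis bm1) //.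
  by rewrite (size_basis (X := in_tuple _) bm1).
rewrite takel_cat ?bt // size_b; apply: dimvS.
apply: (homo_leq (r := fun A B : {vspace V} => (A <= B)%VS)) Ule _ _ _ => //.
by move=> B A C; apply: subv_trans.
Qed.

(** The initial segments of a basis adapted to f span a complete flag. *)
Lemma complete_refinement n (f : flag F d n) :
  exists c : cflag F d, forall i, c (inord (\dim (f i))) = f i.
Proof.
case: f => f /= /and3P[/eqP f0 /eqP f1 /forallP fle].
have f_mono (i j : 'I_n.+1) : (i <= j)%N -> (f i <= f j)%VS.
  by have /forallP/(_ j)/implyP := fle i.
(* The flag as an increasing sequence indexed by nat, constant from n on. *)
pose U m := f (inord (minn m n)).
have [m|b bU bt] := @adapted_basis _ U _ n.
  apply: f_mono; rewrite !inordK ?ltnS ?geq_minr //.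
  by rewrite leq_min geq_minr andbT (leq_trans (geq_minl _ _)).
have bV : basis_of {: 'cV[F]_d} b.
  by rewrite -f1 (_ : ord_max = inord (minn n n)) // minnn; apply/val_inj; rewrite /= inordK.
have size_b : size b = d by rewrite -(size_basis (X := in_tuple b) bV) dim_cV.
pose c := [ffun i : 'I_d.+1 => <<take i b>>%VS].
have c_flag : is_flag c.
  apply/and3P; split.
  - by rewrite ffunE take0 span_nil.
  - by rewrite ffunE take_oversize ?size_b // (span_basis bV).
  apply/forallP=> i; apply/forallP=> j; apply/implyP=> ij; rewrite !ffunE.
  by apply: sub_span => v; rewrite -(take_takel b ij) => /mem_take.
have c_complete : is_complete_flag (Flag c_flag).
  apply/forallP=> i; rewrite /= ffunE; apply/eqP.
  have := basis_free bV; rewrite -{1}(cat_take_drop i b) => /catl_free.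
  by rewrite /free size_takel ?size_b -1?ltnS // => /eqP.
exists (CFlag c_complete) => i; rewrite /= ffunE inordK; last first.
  by rewrite ltnS -[X in (_ <= X)%N]dim_cV dimvS ?subvf.
have Ui : U i = f i.
  by rewrite /U (minn_idPl _) ?inord_val // -ltnS.
by rewrite -[RHS]Ui -(bt i) ?Ui // -ltnS.
Qed.

Section Coarsening.
Variables (n : nat) (a : 'I_n.+1 -> 'I_d.+1).
Hypothesis a0 : a ord0 = ord0.
Hypothesis a1 : a ord_max = ord_max.
Hypothesis a_mono : forall i j : 'I_n.+1, (i <= j)%N -> (a i <= a j)%N.

Fact coarsen_subproof (c : flag F d d) : is_flag [ffun i => c (a i)].
Proof.
case: c => c /= /and3P[/eqP c0 /eqP c1 /forallP cle]; apply/and3P; split.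
- by rewrite ffunE a0 c0.
- by rewrite ffunE a1 c1.
apply/forallP=> i; apply/forallP=> j; apply/implyP=> /a_mono aij.
by rewrite !ffunE; have /forallP/(_ (a j))/implyP := cle (a i); apply.
Qed.

Definition coarsen (p : Yset F d) : Xset F d n :=
  (Flag (coarsen_subproof p.1), p.2).

Lemma coarsen_equivariant : equivariant coarsen.
Proof.
move=> [w g] [c v]; congr (_, _).
by apply/val_inj/ffunP => i; rewrite /= !ffunE.
Qed.

End Coarsening.
End Flags.

(** * The double centralizer property *)

Section DoubleCentralizer.
Variables (R : comNzRingType) (gT : finGroupType) (X Y : gset gT).
Local Notation M := (invfun R X Y).
Local Notation right_op := (fun b : convalg R Y => rconv b : {linear M -> M}).
Local Notation left_op := (fun a : convalg R X => lconv a : {linear M -> M}).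

Lemma left_double_centralizer (I : finType) (u : I -> Y -> X) :
    (forall m, (0 < m)%N -> GRing.lreg (m%:R : R)) ->
    (forall i, equivariant (u i)) -> (forall p, exists i y, u i y = p) ->
  exists f : convalg R X -> endo right_op,
    [/\ linear f,
        f 1 = 1 /\ (forall a a' : convalg R X, f (a * a') = f a * f a'),
        forall (a : convalg R X) (x : M), f a x = conv a x
      & bijective f].
Proof.
move=> natr_cancel uG u_cover.
have lconv_endo (a : convalg R X) : is_endo right_op (lconv a).
  by apply/is_endoP; split=> [|b x]; [exact: linearP | exact: convA].
have f_onto (e : endo right_op) : exists a, forall x, e x = conv a x.
  case: e => e eE; have /is_endoP[eL eB] := eE.
  pose eLin : {linear M -> M} :=
    HB.pack e (GRing.isLinear.Build R M M *:%R e eL).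
  exact: (rconv_commutant natr_cancel uG u_cover (f := eLin) eB).
have [f' f'E] := choice f_onto.
exists (fun a => Endo (lconv_endo a)); split=> //.
- by move=> c a a'; apply/endoP => x; apply: (etrans (convDl _ _ _)); rewrite convZl.
- split; first by apply/endoP => x; apply: conv1l.
  by move=> a a'; apply/endoP => x; rewrite endo_mulE /= /lconv convA.
exists f' => [a|e]; last by apply/endoP => x; apply/esym/f'E.
by apply: (conv_injl uG u_cover) => x; rewrite -f'E.
Qed.

Lemma right_double_centralizer (u : Y -> X) :
    equivariant u -> injective u ->
  exists g : convalg R Y -> endo left_op,
    [/\ linear g,
        g 1 = 1 /\ (forall b b' : convalg R Y, g (b * b') = g b' * g b),
        forall (b : convalg R Y) (x : M), g b x = conv x b
      & bijective g].
Proof.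
move=> uG u_inj.
have rconv_endo (b : convalg R Y) : is_endo left_op (rconv b).
  by apply/is_endoP; split=> [|a x]; [exact: linearP | exact/esym/convA].
have g_onto (e : endo left_op) : exists b, forall x, e x = conv x b.
  case: e => e eE; have /is_endoP[eL eB] := eE.
  exact: (lconv_commutant eB uG u_inj).
have [g' g'E] := choice g_onto.
exists (fun b => Endo (rconv_endo b)); split=> //.
- by move=> c b b'; apply/endoP => x; apply: (etrans (convDr _ _ _)); rewrite convZr.
- split; first by apply/endoP => x; apply: conv1r.
  by move=> b b'; apply/endoP => x; rewrite endo_mulE /= /rconv convA.
exists g' => [b|e]; last by apply/endoP => x; apply/esym/g'E.
by apply: (conv_injr uG u_inj) => x; rewrite -g'E.
Qed.

End DoubleCentralizer.

(** Z[v, v^-1] is a subring of a field of characteristic 0. *)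
Lemma laurentZ_natr_lreg m : (0 < m)%N -> GRing.lreg (m%:R : laurentZ).
Proof.
move=> m_gt0 x y; rewrite !mulr_natl => /(congr1 val); rewrite !raddfMn => xy.
apply/val_inj/eqP; rewrite -subr_eq0 /=; move/eqP: xy; rewrite -subr_eq0 -mulrnBl.
rewrite -mulr_natl mulf_eq0 => /predU1P[/eqP|//].
rewrite -(rmorph_nat (@tofrac _)) tofrac_eq0 -polyC_natr polyC_eq0 Num.Theory.pnatr_eq0.
by rewrite eqn0Ngt m_gt0.
Qed.

Theorem proposition6p1p3 (F : finFieldType) (n d : nat)
    (n_gt0 : (0 < n)%N) (d_gt0 : (0 < d)%N) (le_d_n : (d <= n)%N) :
  (exists f : MS F d n -> End_MH F d n,
     [/\ linear f,
         f 1 = 1 /\ (forall a a' : MS F d n, f (a * a') = f a * f a'),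
         forall (a : MS F d n) (x : MV F d n), f a x = conv a x
       & bijective f])
  /\
  (exists g : MH F d -> End_MS F d n,
     [/\ linear g,
         g 1 = 1 /\ (forall b b' : MH F d, g (b * b') = g b' * g b),
         forall (b : MH F d) (x : MV F d n), g b x = conv x b
       & bijective g]).
Proof.
split.
  (* The covering family is indexed by X itself: a p selects from a complete flag
     the members that have the dimensions of the flag underlying p. *)
  pose a (p : Xset F d n) (i : 'I_n.+1) : 'I_d.+1 := inord (\dim (p.1 i)).
  have dim_le (p : Xset F d n) (i : 'I_n.+1) : (\dim (p.1 i) < d.+1)%N.
    by rewrite ltnS -[X in (_ <= X)%N](dim_cV F) dimvS ?subvf.
  have a0 p : a p ord0 = ord0.
    case: p => [[f fF] w]; have /and3P[/eqP f0 _ _] := fF.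
    by apply: ord_inj; rewrite inordK //= f0 dimv0.
  have a1 p : a p ord_max = ord_max.
    case: p => [[f fF] w]; have /and3P[_ /eqP f1 _] := fF.
    by apply: ord_inj; rewrite inordK //= f1 dim_cV.
  have a_mono p (i j : 'I_n.+1) : (i <= j)%N -> (a p i <= a p j)%N.
    rewrite !inordK // => ij; apply: dimvS; case: p => [[f fF] w].
    by have /and3P[_ _ /forallP/(_ i)/forallP/(_ j)/implyP] := fF; apply.
  apply: (left_double_centralizer
           (u := fun p => coarsen (a0 p) (a1 p) (a_mono p))).
  - exact: laurentZ_natr_lreg.
  - by move=> p; apply: coarsen_equivariant.
  move=> [f w]; have [c cf] := complete_refinement f.
  exists (f, w), (c, w); congr (_, _).
  by apply/val_inj/ffunP => i; rewrite /= ffunE -cf.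
(* A complete flag is turned into a flag with n steps by repeating V. *)
pose a (i : 'I_n.+1) : 'I_d.+1 := inord (minn i d).
have aE i : a i = minn i d :> nat by rewrite inordK // ltnS geq_minr.
have a0 : a ord0 = ord0 by apply/val_inj; rewrite /= aE min0n.
have a1 : a ord_max = ord_max by apply/val_inj; rewrite /= aE; apply/minn_idPr.
have a_mono (i j : 'I_n.+1) : (i <= j)%N -> (a i <= a j)%N.
  by move=> ij; rewrite !aE leq_min geq_minr andbT (leq_trans (geq_minl _ _)).
apply: (@right_double_centralizer _ _ _ _ (coarsen a0 a1 a_mono)).
  exact: coarsen_equivariant.
move=> [c v] [c' v'] [/ffunP cc' ->]; congr (_, _).
apply/val_inj/val_inj/ffunP => i; have := cc' (inord i); rewrite !ffunE.
have -> // : a (inord i) = i.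
have id : (i <= d)%N by rewrite -ltnS.
by apply/val_inj; rewrite /= aE inordK ?(minn_idPl id) // ltnS (leq_trans id).
Qed.
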